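(* Let $p$ be a prime, $G$ a topological group, and $f : G \to \mathbb{Q}_p$ a continuous unbounded quasimorphism with $D(f) = 1$. Let $U := f^{-1}(\mathbb{Z}_p)$ and $k \geq 0$. Then the following are equivalent: 1. $d_H(f) > p^k$. 2. For every open subgroup $K \leq G$ of index at most $p^k$, the map $\pi\circ f|_K : K \to \mathbb{Z}(p^\infty)$ does not factor through a continuous homomorphism $K \to \mathbb{Q}_p$, i.e. there is no continuous homomorphism $h:K\to\mathbb{Q}_p$ with $\pi\circ f|_K=\pi\circ h$. 3. For every open subgroup $K \leq G$ of index at most $p^k$, every sequence $U \cap K =: U_0 \geq U_1 \geq \cdots$ of open normal subgroups of $K$ such that $K/U_j \cong \mathbb{Z}(p^\infty)$ for all $j$ eventually stabilizes. Moreover, the equivalences remain true if in conditions 2 and 3 ''of index at most $p^k$'' is replaced by ''of index dividing $p^k$'' and $K$ is additionally required to be normal in $G$.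
   Context: A quasimorphism is a map $f:G\to\mathbb{Q}_p$ whose defect $D(f)=\sup_{g,h\in G}|f(gh)-f(g)-f(h)|_p$ is finite. $d_H(f)=\inf\{\|f-h\|_\infty : h:G\to\mathbb{Q}_p \text{ continuous homomorphism}\}$. $\mathbb{Z}(p^\infty)=\mathbb{Q}_p/\mathbb{Z}_p$ is the Prüfer $p$-group (with discrete topology), and $\pi:\mathbb{Q}_p\to\mathbb{Q}_p/\mathbb{Z}_p$ the canonical projection; when $D(f)\le1$, $\pi\circ f$ is a continuous homomorphism. *)

(* Defs.v *)
From HB Require Import structures.
From mathcomp Require Import all_boot all_order all_algebra.
From mathcomp Require Import all_classical all_reals all_analysis.
From mathcomp Require Import ring lra.

Set Implicit Arguments.
Unset Strict Implicit.
Unset Printing Implicit Defensive.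
Import Order.TTheory GRing.Theory Num.Theory.
Local Open Scope ring_scope.
Local Open Scope classical_set_scope.

(* A concrete model of the p-adic numbers Q_p (as an additive normed group). *)
(* Q_p = lim_n Q_p / p^n Z_p  and  Q_p / p^n Z_p = Z[1/p] / p^n Z, so an     *)
(* element of Q_p is a sequence (x_n)_n of rationals with p-power            *)
(* denominators, 0 <= x_n < p^n (canonical representative mod p^n), with    *)
(* x_{n+1} = x_n mod p^n.  (x_n is the residue of x modulo p^n Z_p.)         *)
(* For a prime p, [pb p] = p; the [maxn 1 p] only avoids the degenerate p=0. *)

Definition pb (p : nat) : nat := maxn 1 p.
Definition ppow (p n : nat) : rat := ((pb p) ^ n)%:R.

Definition pden (p : nat) (r : rat) : Prop := exists m, r * ppow p m \is a Num.int.

Definition modq (p n : nat) (r : rat) : rat :=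
  r - ppow p n * (Num.floor (r / ppow p n))%:~R.

Definition padic_seq (p : nat) (x : nat -> rat) : Prop :=
  forall n, [/\ 0 <= x n, x n < ppow p n, pden p (x n)
              & (x n.+1 - x n) / ppow p n \is a Num.int].

Record Qp (p : nat) := MkQp { qp_seq : nat -> rat; qp_ok : padic_seq p qp_seq }.

Lemma ppow_gt0 p n : 0 < ppow p n.
Proof. by rewrite /ppow ltr0n expn_gt0 /pb leq_max. Qed.

Lemma ppowS p n : ppow p n.+1 = ppow p n * (pb p)%:R.
Proof. by rewrite /ppow expnS natrM mulrC. Qed.

Lemma ppow_int p n : ppow p n \is a Num.int.
Proof. by rewrite /ppow rpred_nat. Qed.

Lemma modq_padic p (w : nat -> rat) :
  (forall n, pden p (w n)) ->
  (forall n, (w n.+1 - w n) / ppow p n \is a Num.int) ->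
  padic_seq p (fun n => modq p n (w n)).
Proof.
move=> hden hcomp n; have P0 := ppow_gt0 p n; have P0' : ppow p n != 0 by rewrite gt_eqF.
split.
- have h := floor_le (w n / ppow p n); rewrite ler_pdivlMr // in h.
  by rewrite /modq subr_ge0 mulrC.
- have h := floorD1_gt (w n / ppow p n); rewrite ltr_pdivrMr // in h.
  by rewrite /modq ltrBlDl; rewrite intrD mulrDl mul1r mulrC in h.
- have [m hm] := hden n; exists m.
  by rewrite /modq mulrBl rpredB // -mulrA rpredM ?ppow_int // rpredM ?ppow_int ?rpred_int.
- rewrite /modq ppowS.
  set a := Num.floor _; set b := Num.floor _.
  have -> : (w n.+1 - ppow p n * (pb p)%:R * a%:~R - (w n - ppow p n * b%:~R)) / ppow p n
          = (w n.+1 - w n) / ppow p n - (pb p)%:R * a%:~R + b%:~R.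
    by field.
  by rewrite rpredD ?rpred_int // rpredB ?hcomp // rpredM ?rpred_nat ?rpred_int.
Qed.

Lemma padic_pden p x n : padic_seq p x -> pden p (x n).
Proof. by move=> /(_ n) []. Qed.

Lemma padic_lin p x y (c : int) : padic_seq p x -> padic_seq p y ->
  padic_seq p (fun n => modq p n (x n + c%:~R * y n)).
Proof.
move=> hx hy; apply: modq_padic => n.
- have [a ha] := padic_pden n hx; have [b hb] := padic_pden n hy.
  exists (a + b)%N; rewrite /ppow expnD natrM.
  have -> : (x n + c%:~R * y n) * (((pb p) ^ a)%:R * ((pb p) ^ b)%:R)
     = (x n * ppow p a) * ((pb p) ^ b)%:R + c%:~R * ((y n * ppow p b) * ((pb p) ^ a)%:R).
    by rewrite /ppow; ring.
  apply: rpredD; first by apply: rpredM => //; exact: rpred_nat.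
  apply: rpredM; first exact: rpred_int.
  by apply: rpredM => //; exact: rpred_nat.
- have [_ _ _ h1] := hx n; have [_ _ _ h2] := hy n.
  have -> : (x n.+1 + c%:~R * y n.+1 - (x n + c%:~R * y n)) / ppow p n
     = (x n.+1 - x n) / ppow p n + c%:~R * ((y n.+1 - y n) / ppow p n).
    by have := ppow_gt0 p n; rewrite lt0r => /andP[h _]; field.
  by rewrite rpredD // rpredM ?rpred_int.
Qed.

Lemma padic0 p : padic_seq p (fun _ => 0).
Proof.
move=> n; split => //; first exact: ppow_gt0.
  by exists 0%N; rewrite mul0r rpred0.
by rewrite subrr mul0r rpred0.
Qed.

Definition qp0 p : Qp p := MkQp (padic0 p).
Definition qp_add p (x y : Qp p) : Qp p := MkQp (padic_lin 1 (qp_ok x) (qp_ok y)).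
Definition qp_sub p (x y : Qp p) : Qp p := MkQp (padic_lin (-1) (qp_ok x) (qp_ok y)).

(* The p-adic absolute value |x|_p (rational-valued).  If n0 is the least n *)
(* with x_n <> 0 then: n0 = 0 means x is not in Z_p and |x|_p is the        *)
(* (p-power) denominator of x_0; n0 >= 1 means x is in p^(n0-1) Z_p but not *)
(* in p^n0 Z_p, so |x|_p = p^-(n0-1).                                        *)
Definition pnorm p (x : Qp p) : rat :=
  match pselect (exists n, qp_seq x n != 0) with
  | left H => let n0 := @ex_minn (fun n => qp_seq x n != 0) H in
              if n0 == 0%N then (denq (qp_seq x 0))%:~R else (ppow p n0.-1)^-1
  | right _ => 0
  end.

Definition pabs (R : realType) p (x : Qp p) : R := ratr (pnorm x).

(* The Pruefer group Z(p^oo) = Q_p/Z_p, modelled as the rationals in [0,1)  *)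
(* with p-power denominator, with addition modulo 1.  The canonical          *)
(* projection pi : Q_p -> Q_p/Z_p is x |-> x_0 (the residue of x mod Z_p).  *)
Definition prufer (p : nat) (r : rat) : Prop := [/\ 0 <= r, r < 1 & pden p r].
Definition prufer_add (p : nat) (r s : rat) : rat := modq p 0 (r + s).
Definition qp_proj p (x : Qp p) : rat := qp_seq x 0.
Definition in_Zp p (x : Qp p) : Prop := qp_proj x = 0.

Definition is_topgroup (G : topologicalType) (mul : G -> G -> G) (e : G)
  (inv : G -> G) : Prop :=
  [/\ associative mul, left_id e mul, left_inverse e inv mul,
      continuous (fun xy : G * G => mul xy.1 xy.2) & continuous inv].

Record topgrp := TopGrp {
  tg_car :> topologicalType;
  tg_mul : tg_car -> tg_car -> tg_car;
  tg_one : tg_car;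
  tg_inv : tg_car -> tg_car;
  tg_ax : is_topgroup tg_mul tg_one tg_inv }.

Section Groups.
Variables (G : topgrp).
Local Notation gmul := (@tg_mul G).
Local Notation ginv := (@tg_inv G).
Local Notation g1 := (@tg_one G).

Definition is_subgroup (K : set G) : Prop :=
  K g1 /\ (forall x y, K x -> K y -> K (gmul x (ginv y))).

Definition is_normal_in (N K : set G) : Prop :=
  is_subgroup N /\ N `<=` K /\ (forall x y, K x -> N y -> N (gmul (gmul x y) (ginv x))).

Definition lcoset (g : G) (K : set G) : set G := [set gmul g k | k in K].

Definition has_index (K : set G) (n : nat) : Prop :=
  ([set lcoset g K | g in [set: G]] #= `I_n)%card.

(* K/N is isomorphic (as an abstract group) to Z(p^oo), expressed by the    *)
(* first isomorphism theorem: a surjective homomorphism K -> Z(p^oo) with    *)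
(* kernel N.                                                                 *)
Definition quot_iso_prufer (p : nat) (K N : set G) : Prop :=
  exists phi : G -> rat,
  [/\ forall x, K x -> prufer p (phi x),
      forall x y, K x -> K y -> phi (gmul x y) = prufer_add p (phi x) (phi y),
      forall r, prufer p r -> exists2 x, K x & phi x = r
    & forall x, K x -> (N x <-> phi x = 0)].

Variables (R : realType) (p : nat).

Definition qp_cont_on (A : set G) (h : G -> Qp p) : Prop :=
  forall g, A g -> forall eps : R, 0 < eps ->
    \forall x \near g, A x -> pabs R (qp_sub (h x) (h g)) < eps.

Definition qp_hom_on (A : set G) (h : G -> Qp p) : Prop :=
  forall x y, A x -> A y -> h (gmul x y) = qp_add (h x) (h y).

Definition qp_bounded (f : G -> Qp p) : Prop :=
  exists M : R, forall g, pabs R (f g) <= M.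

Definition defect (f : G -> Qp p) : \bar R :=
  ereal_sup [set d | exists g h : G,
                 d = (pabs R (qp_sub (qp_sub (f (gmul g h)) (f g)) (f h)))%:E].

Definition dH (f : G -> Qp p) : \bar R :=
  ereal_inf [set ereal_sup [set (pabs R (qp_sub (f g) (h g)))%:E | g in [set: G]]
            | h in [set h | qp_hom_on [set: G] h /\ qp_cont_on [set: G] h]].

Definition no_factorization (f : G -> Qp p) (K : set G) : Prop :=
  ~ exists h : G -> Qp p,
      [/\ qp_hom_on K h, qp_cont_on K h
        & forall g, K g -> qp_proj (f g) = qp_proj (h g)].

Definition chains_stabilize (f : G -> Qp p) (K : set G) : Prop :=
  forall Useq : nat -> set G,
    Useq 0%N = [set g | in_Zp (f g)] `&` K ->
    (forall j, Useq j.+1 `<=` Useq j) ->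
    (forall j, open (Useq j) /\ is_normal_in (Useq j) K /\ quot_iso_prufer p K (Useq j)) ->
    exists N, forall j, (N <= j)%N -> Useq j = Useq N.

End Groups.

(* Main.v *)
Require Import Defs.
From HB Require Import structures.
From mathcomp Require Import all_boot all_order all_algebra.
From mathcomp Require Import all_classical all_reals all_analysis.
From mathcomp Require Import ring lra zify.
Set Implicit Arguments.
Unset Strict Implicit.
Unset Printing Implicit Defensive.
Import Order.TTheory GRing.Theory Num.Theory.
Local Open Scope ring_scope.
Local Open Scope classical_set_scope.

(* Since D(f) <= 1, [pi o f] is a homomorphism onto Z(p^oo).

   If h is a continuous homomorphism with |f - h| <= p^k, then [pi o (f - h)]
   is a homomorphism to the cyclic group p^-k Z_p / Z_p, and [pi o f] lifts to h
   on its kernel, which is open, normal and of index dividing p^k. Conversely,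
   if h lifts [pi o f] on an open subgroup K of index n <= p^k, the transfer T
   of h satisfies |T - n f| <= 1, so T / n is a homomorphism on G at distance
   at most |n|_p^-1 <= n <= p^k from f.

   A lift h on K yields the strictly decreasing chain U_j = h^-1(p^j Z_p). From
   a chain that does not stabilize, a lift is obtained as follows: for j large
   enough in terms of m, U_0 / U_j contains the p^m-torsion of the divisible
   group K / U_j, so that h(x) := p^m f(y) mod p^m Z_p, for any y with
   y^(p^m) in x U_j, is well defined. *)

Local Notation "x ∙ y" := (@tg_mul _ x y) (at level 40, left associativity).
Local Notation ginv := (@tg_inv _).
Local Notation g1 := (@tg_one _).

(** * Rationals modulo [p^n Z] *)

Lemma ppow_neq0 p n : ppow p n != 0.
Proof. by rewrite gt_eqF ?ppow_gt0. Qed.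

Lemma ppow0 p : ppow p 0 = 1.
Proof. by rewrite /ppow expn0. Qed.

Lemma ppowD p m n : ppow p (m + n) = ppow p m * ppow p n.
Proof. by rewrite /ppow expnD natrM. Qed.

Section Congruence.
Variable p : nat.

(** Congruence modulo [p^n Z] on all rationals. Identities in Q_p are checked with it, one precision
    at a time, without tracking the representatives chosen by [modq]; [eqm_inj] turns it back into
    equality on [[0, p^n)]. *)
Definition eqm n (r s : rat) := (r - s) / ppow p n \is a Num.int.

Lemma eqm_refl n r : eqm n r r.
Proof. by rewrite /eqm subrr mul0r rpred0. Qed.

Lemma eqm_sym n r s : eqm n r s -> eqm n s r.
Proof. by rewrite /eqm -opprB mulNr rpredN. Qed.

Lemma eqm_trans n s r t : eqm n r s -> eqm n s t -> eqm n r t.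
Proof.
rewrite /eqm => h1 h2.
by rewrite -(subrK s r) -addrA mulrDl rpredD.
Qed.

Lemma eqmD n r s r' s' : eqm n r s -> eqm n r' s' -> eqm n (r + r') (s + s').
Proof. by rewrite /eqm => h1 h2; rewrite opprD addrACA mulrDl rpredD. Qed.

Lemma eqmN n r s : eqm n r s -> eqm n (- r) (- s).
Proof. by rewrite /eqm -opprD mulNr rpredN. Qed.

Lemma eqmB n r s r' s' : eqm n r s -> eqm n r' s' -> eqm n (r - r') (s - s').
Proof. by move=> h1 h2; apply: eqmD => //; apply: eqmN. Qed.

Lemma eqmMz n (z : rat) r s : z \is a Num.int -> eqm n r s -> eqm n (z * r) (z * s).
Proof. by rewrite /eqm => hz h; rewrite -mulrBr -mulrA rpredM. Qed.

Lemma eqmMn n k r s : eqm n r s -> eqm n (r *+ k) (s *+ k).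
Proof. by move=> h; rewrite -[r *+ k]mulr_natl -[s *+ k]mulr_natl; apply: eqmMz => //; exact: rpred_nat. Qed.

Lemma eqm_sum n (I : finType) (F F' : I -> rat) :
  (forall i, eqm n (F i) (F' i)) -> eqm n (\sum_i F i) (\sum_i F' i).
Proof.
move=> h; apply: (big_ind2 (eqm n)) => //; first exact: eqm_refl.
by move=> *; apply: eqmD.
Qed.

Lemma eqm0 n r : eqm n r 0 = (r / ppow p n \is a Num.int).
Proof. by rewrite /eqm subr0. Qed.

Lemma eqm0P r s : eqm 0 r s = (r - s \is a Num.int).
Proof. by rewrite /eqm ppow0 divr1. Qed.

Lemma eqm_le m n r s : (m <= n)%N -> eqm n r s -> eqm m r s.
Proof.
move=> /subnKC <- h; rewrite /eqm.
have -> : (r - s) / ppow p m = (r - s) / ppow p (m + (n - m)) * ppow p (n - m).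
  by rewrite ppowD; field; rewrite !ppow_neq0.
by rewrite rpredM ?ppow_int.
Qed.

Lemma modq_eqm n r : eqm n (modq p n r) r.
Proof.
rewrite /eqm /modq addrAC subrr add0r mulNr rpredN mulrAC mulfV ?ppow_neq0 // mul1r.
exact: rpred_int.
Qed.

Lemma eqm_inj n r s : 0 <= r -> r < ppow p n -> 0 <= s -> s < ppow p n ->
  eqm n r s -> r = s.
Proof.
move=> r0 rP s0 sP /intrP [z hz]; have P0 := ppow_gt0 p n.
have e : r - s = z%:~R * ppow p n by rewrite -hz divfK ?ppow_neq0.
have : `|r - s| < ppow p n by rewrite ltr_norml; apply/andP; split; lra.
rewrite e normrM (gtr0_norm P0) gtr_pMl // -intr_norm ltrz1 => h.
have z0 : z = 0 by lia.
by move: e; rewrite z0 mul0r => /eqP; rewrite subr_eq0 => /eqP.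
Qed.

Lemma modq_range n r : 0 <= modq p n r < ppow p n.
Proof.
have P0 := ppow_gt0 p n.
have h := floor_le (r / ppow p n); rewrite ler_pdivlMr // in h.
have h' := floorD1_gt (r / ppow p n); rewrite ltr_pdivrMr // in h'.
by rewrite /modq subr_ge0 mulrC h /= ltrBlDl; rewrite intrD mulrDl mul1r in h'.
Qed.

Lemma pden_le r a b : (a <= b)%N -> r * ppow p a \is a Num.int -> r * ppow p b \is a Num.int.
Proof. by move=> /subnKC <- h; rewrite ppowD mulrA rpredM ?ppow_int. Qed.

Lemma pdenD r s : pden p r -> pden p s -> pden p (r + s).
Proof.
move=> [a ha] [b hb]; exists (maxn a b); rewrite mulrDl rpredD //.
  by apply: pden_le ha; rewrite leq_maxl.
by apply: pden_le hb; rewrite leq_maxr.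
Qed.

Lemma pdenM z r : z \is a Num.int -> pden p r -> pden p (z * r).
Proof. by move=> hz [a ha]; exists a; rewrite -mulrA rpredM. Qed.

Lemma pdenV n r : pden p r -> pden p (r / ppow p n).
Proof.
move=> [a ha]; exists (n + a)%N; by rewrite ppowD mulrA divfK ?ppow_neq0.
Qed.

End Congruence.

(** * Q_p as an abelian group *)

Section Qp_zmod.
Variable p : nat.
Implicit Types x y z : Qp p.

Lemma qp_eq x y : (forall n, qp_seq x n = qp_seq y n) -> x = y.
Proof.
case: x => x hx; case: y => y hy /= /funext e; subst y.
by rewrite (Prop_irrelevance hx hy).
Qed.

Lemma qp_ge0 x n : 0 <= qp_seq x n. Proof. by case: (qp_ok x n). Qed.
Lemma qp_lt x n : qp_seq x n < ppow p n. Proof. by case: (qp_ok x n). Qed.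
Lemma qp_pden x n : pden p (qp_seq x n). Proof. by case: (qp_ok x n). Qed.

Lemma qp_eqm m n x : (m <= n)%N -> eqm p m (qp_seq x n) (qp_seq x m).
Proof.
move=> /subnKC <-; elim: (n - m)%N => [|k IH]; first by rewrite addn0 eqm_refl.
rewrite addnS; apply: eqm_trans IH.
by apply: (@eqm_le _ _ (m + k)); [rewrite leq_addr | case: (qp_ok x (m + k))].
Qed.

Lemma qp_eqm_eq x y n : eqm p n (qp_seq x n) (qp_seq y n) -> qp_seq x n = qp_seq y n.
Proof. by apply: eqm_inj; rewrite ?qp_ge0 ?qp_lt. Qed.

Lemma qp_eqmP x y : (forall n, eqm p n (qp_seq x n) (qp_seq y n)) -> x = y.
Proof. by move=> h; apply: qp_eq => n; exact: qp_eqm_eq. Qed.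

Lemma qp_seq_add x y n : eqm p n (qp_seq (qp_add x y) n) (qp_seq x n + qp_seq y n).
Proof. by rewrite -[qp_seq y n]mul1r; exact: modq_eqm. Qed.

Lemma qp_seq_sub x y n : eqm p n (qp_seq (qp_sub x y) n) (qp_seq x n - qp_seq y n).
Proof. by rewrite -mulN1r; exact: modq_eqm. Qed.

Lemma qp_addA : associative (@qp_add p).
Proof.
move=> x y z; apply: qp_eqmP => n; apply: eqm_trans (qp_seq_add _ _ _) _.
apply: eqm_trans (eqmD (eqm_refl _ _ _) (qp_seq_add _ _ _)) _.
apply: eqm_sym; apply: eqm_trans (qp_seq_add _ _ _) _.
by rewrite addrA; apply: eqmD (qp_seq_add _ _ _) (eqm_refl _ _ _).
Qed.

Lemma qp_addC : commutative (@qp_add p).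
Proof.
move=> x y; apply: qp_eqmP => n; apply: eqm_trans (qp_seq_add _ _ _) _.
by rewrite addrC; apply: eqm_sym; exact: qp_seq_add.
Qed.

Lemma qp_add0 : left_id (qp0 p) (@qp_add p).
Proof.
by move=> x; apply: qp_eqmP => n; apply: eqm_trans (qp_seq_add _ _ _) _; rewrite add0r eqm_refl.
Qed.

Lemma qp_addN : left_inverse (qp0 p) (qp_sub (qp0 p)) (@qp_add p).
Proof.
move=> x; apply: qp_eqmP => n; apply: eqm_trans (qp_seq_add _ _ _) _.
have := eqmD (qp_seq_sub (qp0 p) x n) (eqm_refl p n (qp_seq x n)).
by rewrite subrK.
Qed.

End Qp_zmod.

(** Equality and choice are classical here; they serve to declare the additive group, which gives
    access to [*+] and to finite sums in Q_p. *)
HB.instance Definition _ (p : nat) := gen_eqMixin (Qp p).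
HB.instance Definition _ (p : nat) := gen_choiceMixin (Qp p).
HB.instance Definition _ (p : nat) :=
  GRing.isZmodule.Build (Qp p) (@qp_addA p) (@qp_addC p) (@qp_add0 p) (@qp_addN p).

Section Qp_theory.
Variable p : nat.
Implicit Types x y z : Qp p.

Lemma qp_addE x y : qp_add x y = x + y. Proof. by []. Qed.

Lemma qp_subE x y : qp_sub x y = x - y.
Proof.
apply: qp_eqmP => n; apply: eqm_trans (qp_seq_sub _ _ _) _; apply: eqm_sym.
apply: eqm_trans (qp_seq_add _ _ _) _; apply: eqmD (eqm_refl _ _ _) _.
by apply: eqm_trans (qp_seq_sub _ _ _) _; rewrite sub0r eqm_refl.
Qed.

Lemma qp_seqD x y n : eqm p n (qp_seq (x + y) n) (qp_seq x n + qp_seq y n).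
Proof. exact: qp_seq_add. Qed.

Lemma qp_seqB x y n : eqm p n (qp_seq (x - y) n) (qp_seq x n - qp_seq y n).
Proof. by rewrite -qp_subE; exact: qp_seq_sub. Qed.

Lemma qp_seqMn x k n : eqm p n (qp_seq (x *+ k) n) (qp_seq x n *+ k).
Proof.
elim: k => [|k IH]; first by rewrite !mulr0n eqm_refl.
rewrite !mulrS; apply: eqm_trans (qp_seqD _ _ _) _.
exact: eqmD (eqm_refl _ _ _) IH.
Qed.

Lemma qp_seq_sum (I : finType) (F : I -> Qp p) n :
  eqm p n (qp_seq (\sum_i F i) n) (\sum_i qp_seq (F i) n).
Proof.
apply: (big_ind2 (fun x r => eqm p n (qp_seq x n) r)) => [|x r y s h1 h2|i _].
- by rewrite eqm_refl.
- by apply: eqm_trans (qp_seqD _ _ _) _; apply: eqmD.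
- exact: eqm_refl.
Qed.

Lemma qp_seq_eq0 x n : (qp_seq x n = 0) <-> eqm p n (qp_seq x n) 0.
Proof.
split=> [->|h]; first exact: eqm_refl.
by have := @qp_eqm_eq p x 0 n h.
Qed.

Lemma qp_seqB_eq0 x y n : (qp_seq (x - y) n = 0) <-> (qp_seq x n = qp_seq y n).
Proof.
rewrite qp_seq_eq0; split=> [h|e].
  apply: qp_eqm_eq; have := eqmD (eqm_trans (eqm_sym (qp_seqB x y n)) h) (eqm_refl p n (qp_seq y n)).
  by rewrite subrK add0r.
by apply: eqm_trans (qp_seqB _ _ _) _; rewrite e subrr eqm_refl.
Qed.

Lemma qp_seq_eq_le x m n : (m <= n)%N -> qp_seq x n = 0 -> qp_seq x m = 0.
Proof.
move=> le h; apply/qp_seq_eq0/eqm_sym; have := qp_eqm x le.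
by rewrite h.
Qed.

End Qp_theory.

(** * Denominators, division by integers and the absolute value on Q_p *)

Lemma denq_dvd r m : r * m%:R \is a Num.int -> (`|denq r| %| m)%N.
Proof.
move=> /intrP [z hz].
have e : (numq r * m%:Z)%:~R = (z * denq r)%:~R :> rat.
  by rewrite !intrM -hz numqE mulrAC.
move/intr_inj: e => e.
have : (denq r %| numq r * m%:Z)%Z by rewrite e dvdz_mull.
by rewrite Gauss_dvdzr // coprimez_sym /coprimez; have := coprime_num_den r; rewrite /coprime.
Qed.

Section Prime.
Variables (p : nat) (p_pr : prime p).

Lemma ppowE n : ppow p n = (p ^ n)%:R.
Proof. by rewrite /ppow /pb (maxn_idPr (prime_gt0 p_pr)). Qed.

Lemma denq_pow r a : r * ppow p a \is a Num.int ->
  exists2 c, (c <= a)%N & denq r = (p ^ c)%N.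
Proof.
rewrite ppowE => /denq_dvd /(dvdn_pfactor _ _ p_pr) [c ca e].
by exists c => //; rewrite -e gez0_abs.
Qed.

Lemma denq_pow_int r a : denq r = (p ^ a)%N -> r * ppow p a \is a Num.int.
Proof.
by move=> e; rewrite ppowE -[_%:R]/((p ^ a)%N%:Z%:~R) -e -numqE rpred_int.
Qed.

(** The denominator of [r] is a power of p that divides [n], hence it divides the p-part of [n]. *)
Lemma pden_mul_int r n : (0 < n)%N -> pden p r -> r * n%:R \is a Num.int ->
  r * ppow p (logn p n) \is a Num.int.
Proof.
move=> n0 [a ha] hn; have [c ca e] := denq_pow ha.
have := denq_dvd hn; rewrite e absz_nat pfactor_dvdn // => le.
exact: pden_le le (denq_pow_int e).
Qed.

Lemma coprime_inv m N : coprime m p -> exists u z : int, u * m%:Z = 1 + z * (p ^ N)%:Z.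
Proof.
move=> cop; have : coprimez m%:Z (p ^ N)%:Z by rewrite /coprimez /= ; apply/eqP; have := coprimeXr N cop; rewrite /coprime /gcdz => /eqP ->.
move/coprimezP => [[u v] /= e]; exists u, (- v).
by rewrite mulNr -e addrK.
Qed.

(** Write [n = m p^v] with [m] prime to p and [r = a / p^c]. If [u] inverts [m] modulo [p^(N+c)],
    then [w = a u / p^(c+v)] works; the extra [c] digits of [u] absorb the denominator of [r]. *)
Lemma pden_div r n N : (0 < n)%N -> pden p r ->
  exists2 w, pden p w & eqm p N (w *+ n) r.
Proof.
move=> n0 [c /intrP [a ha]].
have [m cop en] := pfactor_coprime p_pr n0.
rewrite coprime_sym in cop; have [u [z e]] := coprime_inv (N + c) cop.
set v := logn p n in en.
have P0 k := ppow_neq0 p k.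
have er : r = a%:~R / ppow p c by rewrite -ha mulfK.
exists (a%:~R * u%:~R / ppow p (c + v)).
  exists (c + v)%N; rewrite divfK // rpredM ?rpred_int //.
have e' : u%:~R * m%:R = 1 + z%:~R * ppow p (N + c) :> rat.
  by rewrite ppowE -[m%:R]/(m%:Z%:~R) -[((p ^ _)%:R)]/((p ^ (N + c))%:Z%:~R) -!intrM e intrD.
rewrite /eqm -mulr_natl en natrM -ppowE ppowD er.
have -> : (m%:R * ppow p v * (a%:~R * u%:~R / (ppow p c * ppow p v)) - a%:~R / ppow p c) / ppow p N
  = (a%:~R * (u%:~R * m%:R - 1) / ppow p c / ppow p N) by field; rewrite !P0.
rewrite e' ppowD.
have -> : a%:~R * (1 + z%:~R * (ppow p N * ppow p c) - 1) / ppow p c / ppow p N = a%:~R * z%:~R.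
  by field; rewrite !P0.
by rewrite rpredM ?rpred_int.
Qed.

(** Here [qp_seq x j = 0] means that [x] lies in [p^j Z_p]. Multiplication by [n] raises the
    valuation by exactly that of [n], so division by [n] costs [logn p n] digits. *)
Lemma qp_mul_small (x : Qp p) n j : (0 < n)%N ->
  qp_seq (x *+ n) (j + logn p n) = 0 -> qp_seq x j = 0.
Proof.
move=> n0; set N := (_ + _)%N => h.
have := qp_seqMn x n N; rewrite h => /eqm_sym; rewrite eqm0 -mulr_natr mulrAC => /(pden_mul_int n0).
move=> /(_ (pdenV _ (qp_pden _ _))) hi; apply/qp_seq_eq0; apply: eqm_trans (eqm_sym (qp_eqm x (leq_addr (logn p n) j))) _.
rewrite eqm0; move: hi; rewrite ppowD invfM mulrA divfK ?ppow_neq0 //.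
Qed.

Lemma qp_torsion_free (x : Qp p) n : (0 < n)%N -> x *+ n = 0 -> x = 0.
Proof. by move=> n0 h; apply: qp_eq => j; apply: (qp_mul_small n0); rewrite h. Qed.

Lemma qp_mulIn (x y : Qp p) n : (0 < n)%N -> x *+ n = y *+ n -> x = y.
Proof.
move=> n0 h; apply/eqP; rewrite -subr_eq0; apply/eqP/(qp_torsion_free n0).
by rewrite mulrnBl h subrr.
Qed.

(** Solve [n w_j = x] modulo [p^(j+v)] for each [j], where [v] is the valuation of [n]. Division by
    [n] loses [v] digits, so the [w_j] are still compatible modulo [p^j] and define an element of
    Q_p. *)
Lemma qp_divisible (x : Qp p) n : (0 < n)%N -> exists y, y *+ n = x.
Proof.
move=> n0; set v := logn p n.
have /choice [w hw] : forall j, exists w, pden p w /\ eqm p (j + v) (w *+ n) (qp_seq x (j + v)).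
  by move=> j; have [w] := pden_div (j + v) n0 (qp_pden x (j + v)); exists w.
have ok : padic_seq p (fun j => modq p j (w j)).
  apply: modq_padic => j; first by case: (hw j).
  have [d1 e1] := hw j; have [d2 e2] := hw j.+1.
  have := eqm_trans (eqm_le (leqnSn _) e2) (qp_eqm x (leqnSn (j + v))).
  move=> /(fun h => eqm_trans h (eqm_sym e1)); rewrite /eqm -mulrnBl -mulr_natr mulrAC.
  move/(pden_mul_int n0); rewrite ppowD invfM mulrA divfK ?ppow_neq0 //; apply.
  by do 2 ! apply: pdenV; apply: pdenD => //; rewrite -mulN1r; apply: pdenM.
exists (MkQp ok); apply: qp_eqmP => j; apply: eqm_trans (qp_seqMn _ _ _) _.
have [d1 e1] := hw j; apply: eqm_trans (qp_eqm x (leq_addr v j)).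
by apply: eqm_trans (eqmMn _ (modq_eqm _ _ _)) _; apply: eqm_le e1; rewrite leq_addr.
Qed.

Lemma pnorm_small (x : Qp p) n : qp_seq x n = 0 -> pnorm x <= (ppow p n)^-1.
Proof.
move=> h; rewrite /pnorm; case: pselect => [H|H] /=; last by rewrite invr_ge0 ltW ?ppow_gt0.
case: ex_minnP => m nz hmin.
have lt : (n < m)%N by rewrite ltnNge; apply: contra nz => le; rewrite (qp_seq_eq_le le h).
case: m lt nz {hmin} => // m; rewrite ltnS => le _ /=.
by rewrite lef_pV2 ?posrE ?ppow_gt0 // !ppowE ler_nat leq_exp2l // prime_gt1.
Qed.

Lemma pnorm_nonint (x : Qp p) : qp_seq x 0 != 0 -> pnorm x = (denq (qp_seq x 0))%:~R.
Proof.
move=> nz; rewrite /pnorm; case: pselect => [H|[]]; last by exists 0%N.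
by case: ex_minnP => n _ /(_ 0%N nz); rewrite leqn0 => /eqP -> /=.
Qed.

(** Since [a >= 0], both sides hold on Z_p; outside Z_p the absolute value is the denominator of
    [x_0], which is a power of p. *)
Lemma pnorm_le_ppow (x : Qp p) a : pnorm x <= ppow p a <-> qp_seq x 0 * ppow p a \is a Num.int.
Proof.
have [x0|nz] := eqVneq (qp_seq x 0) 0.
  rewrite x0 mul0r rpred0; split=> // _; apply: le_trans (pnorm_small x0) _.
  by rewrite ppow0 invr1 ppowE ler1n expn_gt0 prime_gt0.
rewrite pnorm_nonint //; have [b hb] := qp_pden x 0; have [c cb e] := denq_pow hb.
rewrite e ppowE -[(_ : int)%:~R]/((p ^ c)%:R) ler_nat leq_exp2l ?prime_gt1 // -ppowE.
split=> [ca|ha]; first exact: pden_le ca (denq_pow_int e).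
have [d da e'] := denq_pow ha; suff -> : c = d by [].
by move: e; rewrite e' => -[/eqP]; rewrite eqn_exp2l ?prime_gt1 // => /eqP.
Qed.

(** Absolute values above 1 are powers of p, so a value below [p^(a+1)] is at most [p^a]. *)
Lemma pnorm_lt_ppow (x : Qp p) a : pnorm x < ppow p a.+1 -> qp_seq x 0 * ppow p a \is a Num.int.
Proof.
have [->|nz] := eqVneq (qp_seq x 0) 0; first by rewrite mul0r rpred0.
rewrite pnorm_nonint //; have [b hb] := qp_pden x 0; have [c cb e] := denq_pow hb.
rewrite e ppowE -[(_ : int)%:~R]/((p ^ c)%:R) ltr_nat ltn_exp2l ?prime_gt1 // ltnS => ca.
exact: pden_le ca (denq_pow_int e).
Qed.

Lemma pnorm_smallP (x : Qp p) n : pnorm x < (ppow p n)^-1 -> qp_seq x n = 0.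
Proof.
move=> h; apply/eqP; apply: contraT => nz; exfalso; move: h.
apply/negP; rewrite -leNgt /pnorm; case: pselect => [H|[]]; last by exists n.
have le1 m : 1 <= ppow p m by rewrite ppowE ler1n expn_gt0 prime_gt0.
case: ex_minnP => m _ /(_ n nz) le; case: eqP => m0 /=.
  apply: (@le_trans _ _ 1); first by rewrite invf_le1 ?ppow_gt0.
  by rewrite ler1z -gtz0_ge1 denq_gt0.
rewrite lef_pV2 ?posrE ?ppow_gt0 // !ppowE ler_nat leq_exp2l ?prime_gt1 //.
by rewrite (leq_trans (leq_pred _)).
Qed.

Variable R : realType.

Lemma pabs_le_pow (x : Qp p) a :
  pabs R x <= ((p ^ a)%N%:R : R) <-> qp_seq x 0 * ppow p a \is a Num.int.
Proof. by rewrite -pnorm_le_ppow /pabs -(rmorph_nat (@ratr R)) ler_rat ppowE. Qed.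

Lemma pabs_lt_pow (x : Qp p) a :
  pabs R x < ((p ^ a.+1)%N%:R : R) -> qp_seq x 0 * ppow p a \is a Num.int.
Proof.
by move=> h; apply: pnorm_lt_ppow; rewrite ppowE -(ltr_rat R) rmorph_nat.
Qed.

Lemma ratr_pV n : ratr (ppow p n)^-1 = ((p ^ n)%N%:R : R)^-1.
Proof. by rewrite fmorphV /= ppowE rmorph_nat. Qed.

Lemma pabs_seq_lt (eps : R) : 0 < eps ->
  exists n, forall x : Qp p, qp_seq x n = 0 -> pabs R x < eps.
Proof.
move=> e0; set n := Num.bound eps^-1; exists n => x /pnorm_small h.
apply: (@le_lt_trans _ _ (ratr (ppow p n)^-1)); first by rewrite ler_rat.
rewrite ratr_pV invf_plt ?posrE // ?ltr0n ?expn_gt0 ?prime_gt0 //.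
apply: (@lt_le_trans _ _ n%:R); first by apply: archi_boundP; rewrite invr_ge0 ltW.
by rewrite ler_nat ltnW // ltn_expl // prime_gt1.
Qed.

Lemma pabs_lt_seq (x : Qp p) n : pabs R x < ((p ^ n)%N%:R)^-1 -> qp_seq x n = 0.
Proof. by rewrite -ratr_pV ltr_rat; exact: pnorm_smallP. Qed.

End Prime.

(** * Translations, powers and cosets in a topological group *)

Section TopGroup.
Variable G : topgrp.
Implicit Types (K N : set G) (x y g : G).

Lemma tgA x y z : x ∙ (y ∙ z) = x ∙ y ∙ z.
Proof. by case: (tg_ax G). Qed.

Lemma tg1x x : g1 ∙ x = x.
Proof. by case: (tg_ax G). Qed.

Lemma tgVx x : ginv x ∙ x = g1.
Proof. by case: (tg_ax G). Qed.

Lemma tgKV x y : ginv x ∙ (x ∙ y) = y.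
Proof. by rewrite tgA tgVx tg1x. Qed.

Lemma tgxV x : x ∙ ginv x = g1.
Proof. by rewrite -[x ∙ _](tgKV (ginv x)) (tgA (ginv x) x) tgVx tg1x tgVx. Qed.

Lemma tgx1 x : x ∙ g1 = x.
Proof. by rewrite -(tgVx x) tgA tgxV tg1x. Qed.

Lemma tgK x y : x ∙ (ginv x ∙ y) = y.
Proof. by rewrite tgA tgxV tg1x. Qed.

Lemma tgV_uniq x y : x ∙ y = g1 -> ginv x = y.
Proof. by move=> e; rewrite -[RHS](tgKV x) e tgx1. Qed.

Lemma tgVV x : ginv (ginv x) = x.
Proof. by apply: tgV_uniq; rewrite tgVx. Qed.

Lemma tgVM x y : ginv (x ∙ y) = ginv y ∙ ginv x.
Proof. by apply: tgV_uniq; rewrite -tgA tgK tgxV. Qed.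

Lemma near_mull (P : set G) a x :
  (\forall z \near a ∙ x, P z) -> \forall z \near x, P (a ∙ z).
Proof.
case: (tg_ax G) => _ _ _ c _ h.
have [[A B] [/= nA nB] sub] := c (a, x) _ h.
apply: filterS nB => z Bz; exact: (sub (a, z) (conj (nbhs_singleton nA) Bz)).
Qed.

Lemma near_mulr (P : set G) a x :
  (\forall z \near x ∙ a, P z) -> \forall z \near x, P (z ∙ a).
Proof.
case: (tg_ax G) => _ _ _ c _ h.
have [[A B] [/= nA nB] sub] := c (x, a) _ h.
apply: filterS nA => z Az; exact: (sub (z, a) (conj Az (nbhs_singleton nB))).
Qed.

Fixpoint gpow x n := if n is m.+1 then x ∙ gpow x m else g1.

Lemma gpowD x m n : gpow x (m + n) = gpow x m ∙ gpow x n.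
Proof. by elim: m => [|m IH] /=; rewrite ?tg1x // IH tgA. Qed.

Lemma gpowM x m n : gpow (gpow x m) n = gpow x (m * n).
Proof. by elim: n => [|n IH] /=; rewrite ?muln0 // mulnS gpowD IH. Qed.

Section Subgroup.
Variables (K : set G) (sK : is_subgroup K).

Lemma subgroup1 : K g1. Proof. by case: sK. Qed.

Lemma subgroupV x : K x -> K (ginv x).
Proof. by case: sK => k1 h kx; rewrite -[ginv x]tg1x; apply: h. Qed.

Lemma subgroupM x y : K x -> K y -> K (x ∙ y).
Proof. by case: sK => k1 h kx ky; rewrite -[y]tgVV; apply: h => //; exact: subgroupV. Qed.

Lemma subgroupX x n : K x -> K (gpow x n).
Proof. by move=> kx; elim: n => [|n IH] /=; [exact: subgroup1 | exact: subgroupM]. Qed.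

Lemma lcoset_eq x y : lcoset x K = lcoset y K <-> K (ginv x ∙ y).
Proof.
split=> [e|k].
  have : lcoset x K y by rewrite e; exists g1; [exact: subgroup1 | rewrite tgx1].
  by case=> z kz <-; rewrite tgKV.
apply/seteqP; split=> _ [z kz <-].
  by exists (ginv (ginv x ∙ y) ∙ z); [apply: subgroupM => //; exact: subgroupV | rewrite tgVM tgVV -tgA tgK].
by exists (ginv x ∙ y ∙ z); [exact: subgroupM | rewrite -tgA tgK].
Qed.

(** Replaces the set of cosets by a numbering [c] of them, so that coset representatives and the
    action on cosets can be indexed by ['I_n]. *)
Lemma has_indexP n : has_index K n <-> exists c : G -> nat,
  [/\ forall g, (c g < n)%N, forall i, (i < n)%N -> exists g, c g = i
    & forall x y, c x = c y <-> K (ginv x ∙ y)].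
Proof.
split=> [/card_set_bijP [F [fF iF sF]]|[c [cn sc cK]]].
  exists (fun g => F (lcoset g K)); split.
  - by move=> g; apply: (fF (lcoset g K)); exists g.
  - by move=> i /sF [_ [g _ <-] e]; exists g.
  - move=> x y; split=> [e|/lcoset_eq -> //]; apply/lcoset_eq.
    by apply: iF => //; rewrite inE; eexists.
rewrite /has_index card_eq_sym.
have /choice [t ht] : forall i, exists g, (i < n)%N -> c g = i.
  by move=> i; case: (ltnP i n) => [/sc [g e]|_]; [exists g | exists g1].
suff bij : set_bij `I_n [set lcoset g K | g in [set: G]] (fun i => lcoset (t i) K).
  by apply/card_set_bijP; exists (fun i => lcoset (t i) K).
split.
- by move=> i _; exists (t i).
- move=> i j; rewrite !inE => hi hj /lcoset_eq/cK; by rewrite !ht.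
- move=> _ [g _ <-]; exists (c g); first exact: cn.
  by apply/lcoset_eq/cK; rewrite ht.
Qed.

End Subgroup.

End TopGroup.

(** * Homomorphisms to Q/Z and the subgroups of the Pruefer group *)

Section QZhom.
Variables (p : nat) (p_pr : prime p) (G : topgrp) (K : set G) (sK : is_subgroup K).

(** Additivity modulo Z of a rational-valued map. This covers [pi o f], the isomorphisms onto
    Z(p^oo), and their restrictions to subgroups. *)
Definition qzhom (phi : G -> rat) :=
  forall x y, K x -> K y -> eqm p 0 (phi (x ∙ y)) (phi x + phi y).

Variables (phi : G -> rat) (hphi : qzhom phi).

Lemma qzhom1 : eqm p 0 (phi g1) 0.
Proof.
have := eqmB (hphi (subgroup1 sK) (subgroup1 sK)) (eqm_refl p 0 (phi g1)).
by rewrite tg1x subrr addrK => /eqm_sym.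
Qed.

Lemma qzhomV x : K x -> eqm p 0 (phi (ginv x)) (- phi x).
Proof.
move=> kx; have := eqm_trans (eqm_sym (hphi (subgroupV sK kx) kx)) _.
rewrite tgVx => /(_ _ qzhom1) h.
by have := eqmB h (eqm_refl p 0 (phi x)); rewrite addrK sub0r.
Qed.

Lemma qzhomX x n : K x -> eqm p 0 (phi (gpow x n)) (phi x *+ n).
Proof.
move=> kx; elim: n => [|n IH] /=; first exact: qzhom1.
rewrite mulrS; apply: eqm_trans (hphi kx (subgroupX sK n kx)) _.
exact: eqmD (eqm_refl _ _ _) IH.
Qed.

Lemma qzhomZ x (s : int) : K x -> exists2 y, K y & eqm p 0 (phi y) (s%:~R * phi x).
Proof.
move=> kx; case: s => n.
  by exists (gpow x n); [exact: subgroupX | have := qzhomX n kx; rewrite -mulr_natl].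
exists (ginv (gpow x n.+1)); first exact/(subgroupV sK)/(subgroupX sK).
rewrite NegzE mulrNz mulNr; apply: eqm_trans (qzhomV (subgroupX sK n.+1 kx)) _.
by apply: eqmN; have := qzhomX n.+1 kx; rewrite -mulr_natl.
Qed.

(* The subgroups of Z(p^oo) form a chain: an element of order larger than p^b
   generates the whole p^(b+1)-torsion. *)
Lemma qzhom_torsion x b r : K x -> pden p (phi x) -> ~ phi x * ppow p b \is a Num.int ->
  r * ppow p b.+1 \is a Num.int -> exists2 y, K y & eqm p 0 (phi y) r.
Proof.
move=> kx [a /(denq_pow p_pr) [c ca e]] nb hr.
have bc : (b < c)%N.
  rewrite ltnNge; apply/negP => cb; apply: nb.
  exact: pden_le cb (denq_pow_int p_pr e).
have /intrP [d hd] := pden_le bc hr.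
have : coprimez (numq (phi x)) (denq (phi x)).
  by rewrite /coprimez; have := coprime_num_den (phi x); rewrite /coprime.
(* The order of [phi x] in Q/Z is [p^c]. By Bezout, [u phi(x)] is congruent to [p^-c] modulo Z, so
   [d u phi(x)] is congruent to [d / p^c = r]. *)
move=> /coprimezP [[u v] /= uv].
have [y ky hy] := qzhomZ (d * u) kx; exists y => //; apply: eqm_trans hy _.
rewrite eqm0P; have P0 := ppow_neq0 p c.
have e1 : (u%:~R * phi x + v%:~R) * ppow p c = 1.
  have : (u * numq (phi x) + v * denq (phi x))%:~R = 1 :> rat by rewrite uv.
  by rewrite intrD !intrM numqE e mulrDl -mulrA (ppowE p_pr).
have er : r = d%:~R * (u%:~R * phi x + v%:~R).
  by apply: (mulIf P0); rewrite hd -mulrA e1 mulr1.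
have -> : (d * u)%:~R * phi x - r = - (d * v)%:~R by rewrite er !intrM; ring.
by rewrite rpredN rpred_int.
Qed.

(** Every proper subgroup of Z(p^oo) is finite and killed by some [p^b]; a homomorphism to Z(p^oo)
    whose image no [p^b] kills is therefore onto. *)
Definition qz_unbounded := forall b, exists2 x, K x & ~ phi x * ppow p b \is a Num.int.

Lemma qzhom_surj : (forall x, K x -> prufer p (phi x)) -> qz_unbounded ->
  forall r, prufer p r -> exists2 x, K x & phi x = r.
Proof.
move=> hp unb r [r0 r1 [a ha]].
have [x kx hx] := unb a; have [p0 p1 pd] := hp x kx.
have [y ky hy] := qzhom_torsion kx pd hx (pden_le (leqnSn a) ha).
have [q0 q1 _] := hp y ky.
by exists y => //; apply: (@eqm_inj p 0); rewrite ?ppow0.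
Qed.

End QZhom.

(** * Continuity of maps to Q_p *)

Section Topology.
Variables (R : realType) (p : nat) (p_pr : prime p) (G : topgrp).

(** Small balls of Q_p are the cosets of the [p^n Z_p], so continuity means being locally constant
    modulo each [p^n Z_p]. *)
Lemma qp_contP (A : set G) (h : G -> Qp p) : qp_cont_on R A h <->
  (forall n g, A g -> \forall x \near g, A x -> qp_seq (h x) n = qp_seq (h g) n).
Proof.
split=> [hc n g Ag|hc g Ag eps e0].
  have e0 : 0 < ((p ^ n)%N%:R : R)^-1 by rewrite invr_gt0 ltr0n expn_gt0 prime_gt0.
  apply: filterS (hc g Ag _ e0) => x hx Ax; apply/qp_seqB_eq0; rewrite -qp_subE.
  by apply: (pabs_lt_seq p_pr (R := R)); exact: hx.
have [n hn] := pabs_seq_lt p_pr e0.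
by apply: filterS (hc n g Ag) => x hx Ax; apply: hn; rewrite qp_subE; apply/qp_seqB_eq0; exact: hx.
Qed.

End Topology.

(** * The transfer of a lift from a subgroup of finite index *)

Section Transfer.
Variables (R : realType) (p : nat) (p_pr : prime p) (G : topgrp).
Variables (K : set G) (sK : is_subgroup K) (oK : open K) (n : nat) (iK : has_index K n).
Variables (f h : G -> Qp p).
Hypotheses (hf : qzhom p [set: G] (fun g => qp_seq (f g) 0)).
Hypotheses (hh : qp_hom_on K h) (ch : qp_cont_on R K h).
Hypothesis fh : forall g, K g -> qp_proj (f g) = qp_proj (h g).

Lemma transfer : exists H : G -> Qp p,
  [/\ (0 < n)%N, qp_hom_on [set: G] H, qp_cont_on R [set: G] H
    & forall g, qp_seq ((f g - H g) *+ n) 0 = 0].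
Proof.
have [c [cn sc cK]] := (has_indexP sK n).1 iK.
have n0 : (0 < n)%N by apply: leq_ltn_trans (cn g1).
have /choice [t ct] : forall i : 'I_n, exists g, c g = i by move=> i; exact: sc.
have cM g x y : c x = c y -> c (g ∙ x) = c (g ∙ y).
  by move=> /cK k; apply/cK; rewrite tgVM -tgA tgKV.
(* [s g] is the permutation of the left cosets induced by [g], and [a g i] in [K] is given by
   [g t_i = t_(s g i) (a g i)]. *)
pose s g i : 'I_n := Ordinal (cn (g ∙ t i)).
pose a g i := ginv (t (s g i)) ∙ (g ∙ t i).
have Ka g i : K (a g i) by apply/cK; rewrite ct.
have sM g g' i : s (g ∙ g') i = s g (s g' i).
  by apply: val_inj => /=; rewrite -tgA; apply: cM; rewrite ct.
have aM g g' i : a (g ∙ g') i = a g (s g' i) ∙ a g' i.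
  by rewrite /a sM -!tgA tgK.
have s_inj g : injective (s g).
  move=> i j [] /cK; rewrite tgVM -tgA tgKV => /cK; rewrite !ct; exact: val_inj.
pose T g := \sum_i h (a g i).
(* Sum the cocycle identity [aM] over all cosets, after reindexing the first summand by the
   permutation [s g']. *)
have TM g g' : T (g ∙ g') = T g + T g'.
  rewrite /T [\sum_i h (a g i)](reindex_inj (@s_inj g')) -big_split /=.
  by apply: eq_bigr => i _; rewrite aM hh.
(* Modulo Z_p each summand is [f(g) + f(t_i) - f(t_(s g i))]; the last two terms cancel in the sum
   because [s g] is a permutation. *)
have Tf g : eqm p 0 (qp_seq (T g) 0) (qp_seq (f g) 0 *+ n).
  pose F i := qp_seq (f (t i)) 0.
  have e i : eqm p 0 (qp_seq (h (a g i)) 0) (qp_seq (f g) 0 + (F i - F (s g i))).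
    have := fh (Ka g i); rewrite /qp_proj => <-.
    apply: eqm_trans (hf _ _) _ => //; rewrite addrA [X in eqm _ _ _ X]addrC.
    apply: eqmD; last exact: hf.
    by apply: (qzhomV (K := [set: G]) _ hf).
  apply: eqm_trans (qp_seq_sum _ _) _; apply: eqm_trans (eqm_sum e) _.
  rewrite big_split /= sumr_const card_ord sumrB -(reindex_inj (@s_inj g) (P := xpredT) (F := F)).
  by rewrite subrr addr0 eqm_refl.
(* [H = T / n] exists because Q_p is divisible, and it inherits additivity from [T] because Q_p is
   torsion-free. *)
have /choice [H hH] : forall g, exists y, y *+ n = T g by move=> g; exact: qp_divisible.
exists H; split=> //.
- move=> g g' _ _; rewrite qp_addE; apply: (qp_mulIn p_pr n0).
  by rewrite mulrnDl !hH TM.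
(* Precision [j] for [H] requires precision [j + logn p n] for [T]. Since [K] is open, [x t_i] stays
   in the coset of [g t_i] for [x] near [g], so [a x i] depends continuously on [x] there. *)
- apply/(qp_contP R p_pr) => j g _; set J := (j + logn p n)%N.
  have ca i : \forall x \near g, qp_seq (h (a x i)) J = qp_seq (h (a g i)) J.
    have nK : \forall x \near g, K (ginv (t (s g i)) ∙ (x ∙ t i)).
      apply: (near_mulr (P := fun y => K (ginv (t (s g i)) ∙ y))).
      by apply: near_mull; apply: open_nbhs_nbhs; split => //; exact: Ka.
    have nh : \forall x \near g, K (ginv (t (s g i)) ∙ (x ∙ t i)) ->
        qp_seq (h (ginv (t (s g i)) ∙ (x ∙ t i))) J = qp_seq (h (a g i)) J.
      apply: (near_mulr (P := fun y => K (ginv (t (s g i)) ∙ y) ->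
        qp_seq (h (ginv (t (s g i)) ∙ y)) J = qp_seq (h (a g i)) J)).
      apply: (near_mull (P := fun y => K y -> qp_seq (h y) J = qp_seq (h (a g i)) J)).
      by move/(qp_contP R p_pr): ch => /(_ J (a g i) (Ka g i)).
    apply: filterS2 nK nh => x kx /(_ kx) <-.
    rewrite /a; suff -> : s x i = s g i by [].
    by apply: val_inj => /=; move/cK: kx; rewrite ct => <-.
  apply: filterS (filter_forall _ ca) => x hx _.
  apply/qp_seqB_eq0/(qp_mul_small p_pr n0)/qp_seq_eq0; rewrite mulrnBl !hH.
  apply/qp_seq_eq0/qp_seqB_eq0/qp_eqm_eq; apply: eqm_trans (qp_seq_sum _ _) _.
  by apply: eqm_sym; apply: eqm_trans (qp_seq_sum _ _) _; apply: eqm_sum => i; rewrite hx eqm_refl.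
- move=> g; rewrite mulrnBl hH; apply/qp_seqB_eq0/qp_eqm_eq.
  by apply: eqm_trans (qp_seqMn _ _ _) _; apply: eqm_sym; exact: Tf.
Qed.

End Transfer.

(** * From a lift to a chain that does not stabilize *)

Section Chains.
Variables (R : realType) (p : nat) (p_pr : prime p) (G : topgrp).
Variables (K : set G) (sK : is_subgroup K) (oK : open K).
Variable f : G -> Qp p.

Lemma qp_cont_open (h : G -> Qp p) n : qp_cont_on R K h ->
  open (K `&` [set g | qp_seq (h g) n = 0]).
Proof.
move=> /(qp_contP R p_pr) ch; rewrite openE => g [/= kg hg].
have nK : \forall x \near g, K x by exact: open_nbhs_nbhs.
by apply: filterS2 nK (ch n g kg) => x kx /(_ kx) e; split => //=; rewrite e.
Qed.

Lemma qp_hom_seq (h : G -> Qp p) n x y : qp_hom_on K h -> K x -> K y ->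
  eqm p n (qp_seq (h (x ∙ y)) n) (qp_seq (h x) n + qp_seq (h y) n).
Proof. by move=> hh kx ky; rewrite (hh _ _ kx ky) qp_addE; exact: qp_seqD. Qed.

Lemma qp_hom1 (h : G -> Qp p) : qp_hom_on K h -> h g1 = 0.
Proof.
move=> hh; have := hh _ _ (subgroup1 sK) (subgroup1 sK); rewrite tg1x qp_addE => /eqP.
by rewrite -subr_eq subrr => /eqP.
Qed.

Lemma qp_homV (h : G -> Qp p) x : qp_hom_on K h -> K x -> h (ginv x) = - h x.
Proof.
move=> hh kx; have := hh _ _ (subgroupV sK kx) kx; rewrite tgVx (qp_hom1 hh) qp_addE => /esym/eqP.
by rewrite addr_eq0 => /eqP.
Qed.

Lemma kernel_normal (h : G -> Qp p) n : qp_hom_on K h ->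
  is_normal_in (K `&` [set g | qp_seq (h g) n = 0]) K.
Proof.
move=> hh; split; last first.
  split=> [x []//|x y kx [ky /= hy]]; have kxV := subgroupV sK kx.
  split; first by do 2 ! apply: (subgroupM sK) => //.
  rewrite /= (hh _ _ (subgroupM sK kx ky) kxV) (hh _ _ kx ky) (qp_homV hh kx) !qp_addE.
  by rewrite [h x + _]addrC addrK.
split; first by split; [exact: subgroup1 | rewrite /= (qp_hom1 hh)].
move=> x y [kx /= hx] [ky /= hy]; have kyV := subgroupV sK ky.
split; first exact: (subgroupM sK).
rewrite /= (hh _ _ kx kyV) (qp_homV hh ky) qp_addE; apply/qp_seqB_eq0; by rewrite hx hy.
Qed.

Lemma factor_not_stabilize : qz_unbounded p K (fun g => qp_seq (f g) 0) ->
  ~ no_factorization R f K -> ~ chains_stabilize f K.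
Proof.
move=> unb /contrapT [h [hh ch fh]] st.
pose U j := K `&` [set g | qp_seq (h g) j = 0].
have hphi j : exists phi : G -> rat, [/\ forall x, K x -> prufer p (phi x),
      forall x y, K x -> K y -> phi (x ∙ y) = prufer_add p (phi x) (phi y),
      forall r, prufer p r -> exists2 x, K x & phi x = r
    & forall x, phi x = qp_seq (h x) j / ppow p j].
  (* The map [p^-j h] modulo Z has kernel [U j] on [K] and induces the isomorphism of [K / U j] with
     Z(p^oo). *)
  pose phi g := qp_seq (h g) j / ppow p j; exists phi.
  have hp x : prufer p (phi x).
    split; last by apply: pdenV; exact: qp_pden.
      by rewrite divr_ge0 ?qp_ge0 // ltW // ppow_gt0.
    by rewrite ltr_pdivrMr ?ppow_gt0 // mul1r qp_lt.
  have hom : qzhom p K phi.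
    by move=> x y kx ky; rewrite eqm0P -mulrDl -mulrBl; exact: qp_hom_seq.
  split=> // [x y kx ky|].
    have [a b _] := hp (x ∙ y); have /andP[c d] := modq_range p 0 (phi x + phi y).
    apply: (@eqm_inj p 0 _ _ a _ c d); first by rewrite ppow0.
    by apply: eqm_trans (hom _ _ kx ky) _; apply: eqm_sym; exact: modq_eqm.
  (* If [p^b] kills [p^-j h(x)] modulo Z, it also kills [h(x)], and so [f(x)], modulo Z_p; hence
     unboundedness passes from [f] to [phi]. *)
  apply: (qzhom_surj p_pr sK hom) => // b; have [x kx hx] := unb b; exists x => //.
  move=> ib; apply: hx; have := fh x kx; rewrite /qp_proj => ->.
  have /eqm_sym := qp_eqm (h x) (leq0n j); rewrite eqm0P => i0.
  have i1 : qp_seq (h x) j * ppow p b \is a Num.int.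
    by rewrite -(divfK (ppow_neq0 p j) (qp_seq (h x) j)) mulrAC rpredM ?ppow_int.
  rewrite -(subrK (qp_seq (h x) j) (qp_seq (h x) 0)) mulrDl.
  by apply: rpredD => //; apply: rpredM => //; exact: ppow_int.
have [N hN] : exists N, forall j, (N <= j)%N -> U j = U N.
  apply: st => [|j x [kx /= hx]|j].
  - apply/seteqP; split=> x [/= a b]; split=> //=; first by rewrite /in_Zp fh.
    by rewrite -[LHS](fh x b).
  - by split=> //=; apply: qp_seq_eq_le hx.
  - split; first exact: qp_cont_open.
    split; first exact: kernel_normal.
    have [phi [h1 h2 h3 e]] := hphi j; exists phi; split=> // x kx; rewrite e.
    split=> [[_ /= ->]|/eqP]; first by rewrite mul0r.
    by rewrite mulf_eq0 invr_eq0 (negbTE (ppow_neq0 p j)) orbF => /eqP.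
have [phi [_ _ surj e]] := hphi N.+1.
(* Surjectivity at the value [1/p] gives [x] with [h(x)] congruent to [p^N] modulo [p^(N+1)]: this
   [x] lies in [U N] but not in [U N.+1]. *)
have [x kx hx] : exists2 x, K x & phi x = (ppow p 1)^-1.
  apply: surj; split; first by rewrite invr_ge0 ltW // ppow_gt0.
    by rewrite invf_lt1 ?ppow_gt0 // (ppowE p_pr) ltr1n prime_gt1.
  by exists 1%N; rewrite mulVf ?ppow_neq0.
have hs : qp_seq (h x) N.+1 = ppow p N.
  by rewrite -[LHS](divfK (ppow_neq0 p N.+1)) -e hx -(addn1 N) ppowD mulrCA mulVf ?ppow_neq0 ?mulr1.
have UN : U N x.
  split=> //=; apply/qp_seq_eq0; apply: eqm_trans (eqm_sym (qp_eqm _ (leqnSn N))) _.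
  by rewrite hs eqm0 mulfV ?ppow_neq0.
have : U N.+1 x by rewrite hN.
by case=> _ /=; rewrite hs => /eqP; rewrite (negbTE (ppow_neq0 p N)).
Qed.

End Chains.

(** * From a chain that does not stabilize to a lift *)

Section ChainToHom.
Variables (R : realType) (p : nat) (p_pr : prime p) (G : topgrp).
Variables (K : set G) (sK : is_subgroup K).
Variable f : G -> Qp p.
Local Notation f0 := (fun g => qp_seq (f g) 0).
Hypothesis hf : qzhom p K f0.
Variable U : nat -> set G.
Hypotheses (U0 : U 0%N = [set g | in_Zp (f g)] `&` K).
Hypotheses (dU : forall j, U j.+1 `<=` U j) (oU : forall j, open (U j)).
Hypotheses (nU : forall j, is_normal_in (U j) K).
Variable phi : nat -> G -> rat.
Hypotheses (phi_prufer : forall j x, K x -> prufer p (phi j x)).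
Hypotheses (phi_hom : forall j, qzhom p K (phi j)).
Hypotheses (phi_surj : forall j r, prufer p r -> exists2 x, K x & phi j x = r).
Hypotheses (phi_ker : forall j x, K x -> (U j x <-> phi j x = 0)).
Hypothesis U_unstable : forall N, exists2 j, (N <= j)%N & U j.+1 <> U j.

Let subU j : U j `<=` K. Proof. by case: (nU j) => _ []. Qed.

Let sU j : is_subgroup (U j). Proof. by case: (nU j). Qed.

Let U_le i j : (i <= j)%N -> U j `<=` U i.
Proof. by move=> /subnKC <-; elim: (j - i)%N => [|k IH] x; rewrite ?addn0 // addnS => /dU /IH. Qed.

Let phi_eqm0 j x : K x -> eqm p 0 (phi j x) 0 -> U j x.
Proof.
move=> kx h; apply/(phi_ker j kx); have [a b _] := phi_prufer j kx.
by apply: (@eqm_inj p 0) => //; rewrite ppow0.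
Qed.

Let phi_eqmP j x y : K x -> K y -> eqm p 0 (phi j x) (phi j y) <-> U j (ginv x ∙ y).
Proof.
move=> kx ky; have kV := subgroupV sK kx.
have e : eqm p 0 (phi j (ginv x ∙ y)) (phi j y - phi j x).
  apply: eqm_trans (phi_hom _ kV ky) _; rewrite addrC.
  exact: eqmD (eqm_refl _ _ _) (qzhomV sK (phi_hom j) kx).
split=> h.
  apply: phi_eqm0; first exact: subgroupM.
  apply: eqm_trans e _; have := eqmB (eqm_sym h) (eqm_refl p 0 (phi j x)).
  by rewrite subrr.
have e0 := (phi_ker j (subgroupM sK kV ky)).1 h.
move: e; rewrite e0 => e; apply: eqm_sym.
by have := eqmD (eqm_sym e) (eqm_refl p 0 (phi j x)); rewrite subrK add0r.
Qed.

(* U_0 / U_j contains the p^m-torsion of K / U_j, which holds for large j because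
   each strict step of the chain enlarges U_0 / U_j. *)
Definition roots_determined m j := forall y, K y -> U j (gpow y (p ^ m)) -> U 0%N y.

(** If [y^(p^(m+1))] lies in [U j.+1], then [y^(p^m)] is p-torsion modulo [U j.+1]. The nontrivial
    subgroup [U j / U j.+1] of Z(p^oo) contains all p-torsion, so [y^(p^m)] lies in [U j] and the
    case of [m] and [j] applies. *)
Let roots_determined_step m j : roots_determined m j -> U j.+1 <> U j ->
  roots_determined m.+1 j.+1.
Proof.
move=> T ne y ky hy; apply: T => //.
have [u Uu nu] : exists2 u, U j u & ~ U j.+1 u.
  apply: contrapT => h; apply: ne; apply/seteqP; split; first exact: dU.
  by move=> u Uu; apply: contrapT => nu; apply: h; exists u.
have ku := subU Uu; have kP n := subgroupX sK n ky.
have hom : qzhom p (U j) (phi j.+1) by move=> a b /subU ka /subU kb; exact: phi_hom.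
have nint : ~ phi j.+1 u * ppow p 0 \is a Num.int.
  by rewrite ppow0 mulr1 => h; apply/nu/phi_eqm0 => //; rewrite eqm0P subr0.
have tors : phi j.+1 (gpow y (p ^ m)) * ppow p 1 \is a Num.int.
  have := qzhomX sK (phi_hom j.+1) p (kP (p ^ m)%N); rewrite gpowM -expnSr.
  rewrite ((phi_ker j.+1 (kP _)).1 hy) => /eqm_sym.
  by rewrite eqm0P subr0 (ppowE p_pr) expn1 mulr_natr.
have [_ _ pd] := phi_prufer j.+1 ku.
have [v Uv /(phi_eqmP _ (subU Uv) (kP _)) /dU h] := qzhom_torsion p_pr (sU j) hom Uu pd nint tors.
by rewrite -(tgK v (gpow _ _)); apply: subgroupM.
Qed.

Let roots_determined_le m i j : (i <= j)%N -> roots_determined m i -> roots_determined m j.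
Proof. by move=> ij T y ky /(U_le ij); exact: T. Qed.

Let roots_determined_ex m : exists j, roots_determined m j.
Proof.
elim: m => [|m [i T]]; first by exists 0%N => y ky /=; rewrite tgx1.
have [j ij ne] := U_unstable i; exists j.+1.
exact: roots_determined_step (roots_determined_le ij T) ne.
Qed.

(** The quotient [K / U j] is abelian, so [y^-1 z] is [p^m]-torsion in it and lies in [U 0], the
    kernel of [pi o f] on [K]. *)
Let root_uniq m j y z : roots_determined m j -> K y -> K z ->
  eqm p 0 (phi j (gpow y (p ^ m))) (phi j (gpow z (p ^ m))) -> f0 y = f0 z.
Proof.
move=> T ky kz h; have kV := subgroupV sK ky; have kVz := subgroupM sK kV kz.
have : U 0%N (ginv y ∙ z).
  apply: T => //; apply: phi_eqm0; first exact: subgroupX.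
  apply: eqm_trans (qzhomX sK (phi_hom j) _ kVz) _.
  apply: eqm_trans (eqmMn _ (phi_hom j kV kz)) _; rewrite mulrnDl.
  rewrite -(addNr (phi j y *+ p ^ m)); apply: eqmD.
    by rewrite -mulNrn; apply: eqmMn; exact: (qzhomV sK (phi_hom j)).
  apply: eqm_trans (eqm_sym (qzhomX sK (phi_hom j) _ kz)) _.
  exact: eqm_trans (eqm_sym h) (qzhomX sK (phi_hom j) _ ky).
rewrite U0 => -[/= h0 _]; apply: qp_eqm_eq.
have := hf kV kz; rewrite [qp_seq _ 0]h0 => /(fun h => eqm_trans h (eqmD (qzhomV sK hf ky) (eqm_refl _ _ _))).
move=> h1; have := eqmD (eqm_refl p 0 (f0 y)) h1.
by rewrite addr0 addNKr.
Qed.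

(** Z(p^oo) is divisible: take a preimage under [phi j] of [phi j x / p^m]. *)
Let root_ex m j x : K x -> exists2 y, K y & eqm p 0 (phi j (gpow y (p ^ m))) (phi j x).
Proof.
move=> kx; have [a b d] := phi_prufer j kx.
have P0 := ppow_gt0 p m.
have [|y ky hy] := phi_surj j (r := phi j x / ppow p m).
  split; [by rewrite divr_ge0 // ltW| |exact: pdenV].
  rewrite ltr_pdivrMr // mul1r (lt_le_trans b) //.
  by rewrite (ppowE p_pr) ler1n expn_gt0 prime_gt0.
exists y => //; apply: eqm_trans (qzhomX sK (phi_hom j) _ ky) _.
by rewrite hy -mulr_natr -(ppowE p_pr) divfK ?ppow_neq0 // eqm_refl.
Qed.

Lemma chain_factor : exists h : G -> Qp p,
  [/\ qp_hom_on K h, qp_cont_on R K h & forall g, K g -> qp_proj (f g) = qp_proj (h g)].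
Proof.
have [J TJ] := choice roots_determined_ex.
(* For [x] and [y] in [K], this says that [y^(p^m)] lies in the coset [x U_(J m)]. *)
pose root m x y := K y /\ eqm p 0 (phi (J m) (gpow y (p ^ m))) (phi (J m) x).
have uniq m x y z : root m x y -> root m x z -> f0 y = f0 z.
  move=> [ky hy] [kz hz]; apply: (root_uniq (TJ m)) => //.
  exact: eqm_trans hy (eqm_sym hz).
have /choice [h hE] : forall x, exists q : Qp p, K x -> forall m y, root m x y ->
    qp_seq q m = ppow p m * f0 y.
  move=> x; have [kx|nk] := pselect (K x); last by exists 0.
  have /choice [r hr] : forall m, exists y, root m x y.
    by move=> m; have [y ky hy] := root_ex m (J m) kx; exists y.
  suff ok : padic_seq p (fun m => ppow p m * f0 (r m)).
    by exists (MkQp ok) => _ m y hy /=; rewrite (uniq _ _ _ _ hy (hr m)).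
  move=> m; have P0 := ppow_gt0 p m; split.
  - by rewrite mulr_ge0 ?qp_ge0 // ltW.
  - by rewrite gtr_pMr // -(ppow0 p) qp_lt.
  - exact: pdenM (ppow_int _ _) (qp_pden _ _).
  - have [kz hz] := hr m.+1; have [ky hy] := hr m.
    set z := r m.+1 in kz hz *; set y := r m in ky hy *.
    have kzp := subgroupX sK p kz.
    have down i j a b : (i <= j)%N -> K a -> K b ->
        eqm p 0 (phi j a) (phi j b) -> eqm p 0 (phi i a) (phi i b).
      by move=> ij ka kb /(phi_eqmP _ ka kb)/(U_le ij) ?; apply/phi_eqmP.
    (* The indices [J m] and [J m.+1] come from independent choices. At the smaller one, [p^m]-th
       roots still determine [f], since the property for [m.+1] implies the one for [m]. *)
    have T : roots_determined m (minn (J m) (J m.+1)).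
      case: (leqP (J m) (J m.+1)) => _; first exact: TJ.
      move=> a ka ha; apply: (TJ m.+1) => //.
      by rewrite expnSr -gpowM; exact: (subgroupX (sU _)).
    (* If [z] is a [p^(m+1)]-th root of [x], then [z^p] is a [p^m]-th root, to be compared with [y]
       at the common level. Then [p^(m+1) f(z)] is congruent to [p^m f(z^p) = p^m f(y)] modulo
       [p^m], which is the compatibility of the digits. *)
    have e : f0 y = f0 (gpow z p).
      apply: (root_uniq T) => //.
      apply: eqm_trans (down _ _ _ _ (geq_minl _ _) (subgroupX sK _ ky) kx hy) _.
      rewrite gpowM -expnS; apply: eqm_sym.
      exact: (down _ _ _ _ (geq_minr _ _) (subgroupX sK _ kz) kx hz).
    rewrite e ppowS; have := qzhomX sK hf p kz.
    have -> : (ppow p m * (pb p)%:R * f0 z - ppow p m * f0 (gpow z p)) / ppow p m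
      = (f0 z *+ p - f0 (gpow z p)).
      rewrite -mulr_natl /pb (maxn_idPr (prime_gt0 p_pr)); field.
      exact: ppow_neq0.
    by move/eqm_sym; rewrite eqm0P.
exists h; split.
- move=> x y kx ky; rewrite qp_addE; apply: qp_eqmP => m.
  have [a ka ha] := root_ex m (J m) kx; have [b kb hb] := root_ex m (J m) ky.
  have kab := subgroupM sK ka kb.
  have hab : root m (x ∙ y) (a ∙ b).
    split=> //; apply: eqm_trans (qzhomX sK (phi_hom _) _ kab) _.
    apply: eqm_trans (eqmMn _ (phi_hom _ ka kb)) _; rewrite mulrnDl.
    apply: eqm_sym; apply: eqm_trans (phi_hom _ kx ky) _; apply: eqmD.
      exact: eqm_trans (eqm_sym ha) (qzhomX sK (phi_hom _) _ ka).
    exact: eqm_trans (eqm_sym hb) (qzhomX sK (phi_hom _) _ kb).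
  apply: eqm_sym; apply: eqm_trans (qp_seqD _ _ _) _.
  rewrite (hE _ kx _ _ (conj ka ha)) (hE _ ky _ _ (conj kb hb)) (hE _ (subgroupM sK kx ky) _ _ hab).
  have := hf ka kb; rewrite eqm0P => /= hi.
  by apply: eqm_sym; rewrite /eqm -mulrDr -mulrBr mulrC mulrA mulVf ?ppow_neq0 // mul1r.
- apply/(qp_contP R p_pr) => m g kg.
  (* For [x] in the open coset [g U_(J m)], roots of [g] are also roots of [x], so [h] is constant
     modulo [p^m] there. *)
  have nU' : \forall x \near g, U (J m) (ginv g ∙ x).
    apply: near_mull; rewrite tgVx; apply: open_nbhs_nbhs; split; [exact: oU | exact: subgroup1].
  apply: filterS nU' => x hx kx; have [y ky hy] := root_ex m (J m) kg.
  rewrite (hE _ kg _ _ (conj ky hy)); apply: hE => //; split=> //.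
  by apply: eqm_trans hy _; apply/phi_eqmP.
(* For [m = 0] the element [g] is a root of itself, so [h(g)] and [f(g)] agree modulo Z_p. *)
- move=> g kg; rewrite /qp_proj (hE g kg 0%N g) ?ppow0 ?mul1r //.
  by split=> //=; rewrite tgx1 eqm_refl.
Qed.

End ChainToHom.

Lemma not_stabilize_factor (R : realType) (p : nat) (G : topgrp) (K : set G) (f : G -> Qp p) :
  prime p -> is_subgroup K -> qzhom p K (fun g => qp_seq (f g) 0) ->
  ~ chains_stabilize f K -> ~ no_factorization R f K.
Proof.
move=> p_pr sK hf ns nf; apply: ns => U U0 dU hU; apply: contrapT => unst; apply: nf.
have /choice [phi hphi] : forall j, quot_iso_prufer p K (U j) by move=> j; case: (hU j) => _ [].
apply: (@chain_factor R p p_pr G K sK f hf U U0 dU _ _ phi).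
- by move=> j; case: (hU j).
- by move=> j; case: (hU j) => _ [].
- by move=> j; case: (hphi j).
- move=> j x y kx ky; case: (hphi j) => _ -> // _ _; exact: modq_eqm.
- by move=> j; case: (hphi j).
- by move=> j; case: (hphi j).
(* Without a strict step from [N] on, the chain would be constant from [N] on. *)
- move=> N; apply: contrapT => h; apply: unst; exists N => j /subnKC <-.
  elim: (j - N)%N => [|k IH]; first by rewrite addn0.
  by rewrite addnS -IH; apply: contrapT => ne; apply: h; exists (N + k)%N; rewrite ?leq_addr.
Qed.

(** * Distance to homomorphisms and lifts on subgroups of finite index *)

Section Main.
Variables (R : realType) (p : nat) (p_pr : prime p) (G : topgrp).
Variable f : G -> Qp p.
Local Notation f0 := (fun g => qp_seq (f g) 0).

(** The closed unit ball of Q_p is Z_p, so each [f(xy) - f(x) - f(y)] lies in Z_p. *)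
Lemma defect_qzhom : (defect R f <= 1)%E -> qzhom p [set: G] f0.
Proof.
move=> df x y _ _.
have : ((pabs R (qp_sub (qp_sub (f (x ∙ y)) (f x)) (f y)))%:E <= 1)%E.
  by apply: le_trans df; apply: ereal_sup_ubound; exists x, y.
rewrite lee_fin -[1]/(((p ^ 0)%N)%:R) => /(pabs_le_pow p_pr); rewrite ppow0 mulr1 => h.
have e : eqm p 0 (f0 (x ∙ y) - f0 x - f0 y) 0.
  apply: eqm_trans (eqm_sym _) _; last by rewrite eqm0P subr0; exact: h.
  apply: eqm_trans (qp_seq_sub _ _ _) _.
  exact: eqmB (qp_seq_sub _ _ _) (eqm_refl _ _ _).
by move: e; rewrite !eqm0P subr0 opprD addrA.
Qed.

(** A bound for the denominators of [f] modulo Z_p on [K], combined with those at the finitely many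
    coset representatives, would bound [f] on [G]. *)
Lemma finite_index_unbounded K n : qzhom p [set: G] f0 -> ~ qp_bounded R f ->
  is_subgroup K -> has_index K n -> qz_unbounded p K f0.
Proof.
move=> hf unb sK /(has_indexP sK) [c [cn sc cK]] b.
apply: contrapT => nex; apply: unb.
have hK x : K x -> f0 x * ppow p b \is a Num.int.
  by move=> kx; apply: contrapT => h; apply: nex; exists x.
have /choice [t ct] : forall i : 'I_n, exists g, c g = i by move=> i; exact: sc.
have /choice [d hd] : forall i, exists d, f0 (t i) * ppow p d \is a Num.int.
  by move=> i; exact: qp_pden.
pose B := maxn b (\max_i d i); exists ((p ^ B)%N)%:R => g.
apply/(pabs_le_pow p_pr); pose i := Ordinal (cn g).
have k : K (ginv (t i) ∙ g) by apply/cK; rewrite ct.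
have := hf (t i) (ginv (t i) ∙ g) I I; rewrite tgK eqm0P => h.
rewrite -(subrK (f0 (t i) + f0 (ginv (t i) ∙ g)) (f0 g)) !mulrDl rpredD //.
  by rewrite -mulrDl rpredM ?ppow_int.
rewrite rpredD //.
  by apply: pden_le (hd i); rewrite leq_max [X in _ || X](leq_bigmax (F := d)) orbT.
by apply: pden_le (hK _ k); rewrite leq_maxl.
Qed.

Lemma close_hom_factor (k : nat) : qzhom p [set: G] f0 -> qp_cont_on R [set: G] f ->
  (dH R f <= ((p ^ k)%N%:R)%:E)%E ->
  exists2 K, [/\ open K, is_normal_in K [set: G] & exists2 n, has_index K n & (n %| p ^ k)%N]
    & ~ no_factorization R f K.
Proof.
move=> hf cf dle.
(* A homomorphism near the infimum suffices: at distance less than [p^(k+1)] it is at distance at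
   most [p^k], because absolute values above 1 are powers of p. *)
have lt : (dH R f < ((p ^ k.+1)%N%:R)%:E)%E.
  by apply: le_lt_trans dle _; rewrite lte_fin ltr_nat ltn_exp2l // prime_gt1.
have [_ [h [hh ch] <-] lth] := ereal_inf_lt lt.
have sG : is_subgroup [set: G] by [].
pose psi g := qp_seq (f g - h g) 0.
have psi_hom : qzhom p [set: G] psi.
  move=> x y _ _; apply: eqm_trans (qp_seqB _ _ _) _.
  apply: eqm_sym; apply: eqm_trans (eqmD (qp_seqB _ _ _) (qp_seqB _ _ _)) _.
  rewrite addrACA -opprD; apply: eqm_sym; apply: eqmB; first exact: hf.
  exact: (qp_hom_seq 0 hh).
have psi_k g : psi g * ppow p k \is a Num.int.
  apply: (pabs_lt_pow p_pr (R := R)).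
  rewrite -lte_fin; apply: le_lt_trans lth; apply: ereal_sup_ubound.
  by exists g => //; rewrite qp_subE.
have psi_eq x y : psi x = psi y <-> psi (ginv x ∙ y) = 0.
  have e : eqm p 0 (psi (ginv x ∙ y)) (psi y - psi x).
    by rewrite addrC; apply: eqm_trans (psi_hom _ _ I I) (eqmD (qzhomV sG psi_hom I) (eqm_refl _ _ _)).
  split=> [exy|e0].
    by apply/qp_seq_eq0; move: e; rewrite exy subrr.
  apply/esym/qp_eqm_eq; move: e; rewrite e0 => /eqm_sym /(fun h => eqmD h (eqm_refl p 0 (psi x))).
  by rewrite subrK add0r.
pose K := [set g | psi g = 0].
have hKfh g : K g <-> qp_seq (f g) 0 = qp_seq (h g) 0 by exact: qp_seqB_eq0.
have psi1 : psi g1 = 0 by apply/qp_seq_eq0; exact: (qzhom1 sG psi_hom).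
have sK : is_subgroup K.
  split=> // x y kx ky; apply/qp_seq_eq0; apply: eqm_trans (psi_hom _ _ I I) _.
  rewrite [X in eqm _ _ (X + _) _]kx add0r; apply: eqm_trans (qzhomV sG psi_hom I) _.
  by rewrite [psi y]ky oppr0 eqm_refl.
exists K; last first.
  move=> nf; apply: nf; exists h; split.
  - by move=> x y _ _; exact: hh.
  - by move=> g _ eps e0; apply: filterS (ch g I eps e0) => x hx _; exact: hx.
  - by move=> g /hKfh.
split.
- rewrite openE => g kg.
  have nf := (qp_contP R p_pr _ _).1 cf 0%N g I.
  have nh := (qp_contP R p_pr _ _).1 ch 0%N g I.
  apply: filterS2 nf nh => x /(_ I) ef /(_ I) eh; apply/hKfh; rewrite ef eh.
  exact/hKfh.
- split=> //; split=> // x y _ ky.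
  apply/qp_seq_eq0; apply: eqm_trans (psi_hom _ _ I I) _.
  apply: eqm_trans (eqmD (psi_hom _ _ I I) (qzhomV sG psi_hom I)) _.
  by rewrite [psi y]ky addr0 subrr eqm_refl.
(* Choose [b] least such that [p^b] kills the image of [psi]. The values of [psi] are then exactly
   the multiples of [p^-b] in [[0,1)], so its kernel [K] has index [p^b], and [p^b] divides
   [p^k]. *)
have [b [bk hb hmin]] : exists b, [/\ (b <= k)%N, forall g, psi g * ppow p b \is a Num.int
    & forall b', (b = b'.+1)%N -> exists g, ~ psi g * ppow p b' \is a Num.int].
  have ex : exists b, `[< forall g, psi g * ppow p b \is a Num.int >] by exists k; apply/asboolP.
  have [b hb bmin] := ex_minnP ex.
  exists b; split; [by apply: bmin; apply/asboolP | exact/asboolP |].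
  move=> b' e; apply: contrapT => nex; have : (b <= b')%N; last by rewrite e ltnn.
  by apply: bmin; apply/asboolP => g; apply: contrapT => ng; apply: nex; exists g.
exists (p ^ b)%N; last by rewrite dvdn_exp2l.
apply/(has_indexP sK).
(* The integer [p^b psi(g)] in [[0, p^b)] numbers the cosets of [K]. *)
have /choice [c hc] : forall g, exists c : nat, psi g * ppow p b = c%:R.
  by move=> g; apply/natrP; rewrite natrEint hb mulr_ge0 ?qp_ge0 // ltW // ppow_gt0.
exists c; split.
- by move=> g; rewrite -(ltr_nat rat) -hc -(ppowE p_pr) gtr_pMl ?ppow_gt0 // -(ppow0 p) qp_lt.
- move=> i ib.
  have [y hy] : exists y, psi y = i%:R / ppow p b.
    case eb : b ib hmin => [|b'] ib hmin.
      by move: ib; rewrite expn0 ltnS leqn0 => /eqP ->; exists g1; rewrite psi1 mul0r.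
    (* By minimality of [b], some [psi x] is not killed by [p^(b-1)], so it generates the whole
       [p^b]-torsion. *)
    have [x hx] := hmin b' erefl.
    have [|y _ hy] := qzhom_torsion p_pr sG psi_hom (x := x) I (qp_pden _ _) hx (r := i%:R / ppow p b'.+1).
      by rewrite divfK ?ppow_neq0 // rpred_nat.
    exists y; apply: (@eqm_inj p 0) => //; rewrite ?qp_ge0 ?qp_lt //.
      by rewrite divr_ge0 // ltW // ppow_gt0.
    by rewrite ppow0 ltr_pdivrMr ?ppow_gt0 // mul1r (ppowE p_pr) ltr_nat.
  exists y; apply/eqP; rewrite -(eqr_nat rat) -hc hy divfK ?ppow_neq0 //.
- move=> x y; rewrite -[K _]/(psi _ = 0) -psi_eq; split=> [e|e].
    by apply: (mulIf (ppow_neq0 p b)); rewrite !hc e.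
  by apply/eqP; rewrite -(eqr_nat rat) -!hc e.
Qed.

Lemma factor_close_hom (k : nat) K : qzhom p [set: G] f0 -> open K -> is_subgroup K ->
  (exists2 n, has_index K n & (n <= p ^ k)%N) -> ~ no_factorization R f K ->
  (dH R f <= ((p ^ k)%N%:R)%:E)%E.
Proof.
move=> hf oK sK [n iK nk] /contrapT [h [hh ch fh]].
have [H [n0 hH cH fH]] := transfer p_pr sK oK iK hf hh ch fh.
apply: ge_ereal_inf; exists (ereal_sup [set (pabs R (qp_sub (f g) (H g)))%:E | g in [set: G]]).
  by exists H.
apply: ge_ereal_sup => _ [g _ <-]; rewrite lee_fin qp_subE.
(* Since [n (f - H)] takes values in Z_p, the distance is at most the p-part of [n], which divides
   [n] and so is at most [p^k]. *)
apply: (@le_trans _ _ ((p ^ logn p n)%N%:R)); last first.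
  by rewrite ler_nat (leq_trans _ nk) // dvdn_leq // pfactor_dvdnn.
apply/(pabs_le_pow p_pr)/(pden_mul_int p_pr n0); first exact: qp_pden.
have := qp_seqMn (f g - H g) n 0; rewrite fH => /eqm_sym.
by rewrite eqm0P subr0 mulr_natr.
Qed.

End Main.

Theorem theorem9p28 (R : realType) (p : nat) (G : topgrp) (f : G -> Qp p) (k : nat) :
  prime p ->
  qp_cont_on R [set: G] f ->
  ~ qp_bounded R f ->
  defect R f = 1%E ->
  let cond1 := (((p ^ k)%N%:R : R)%:E < dH R f)%E in
  let adm (K : set G) :=
    [/\ open K, is_subgroup K & exists2 n, has_index K n & (n <= p ^ k)%N] in
  let admN (K : set G) :=
    [/\ open K, is_normal_in K [set: G] & exists2 n, has_index K n & (n %| p ^ k)%N] in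
  [/\ cond1 <-> (forall K, adm K -> no_factorization R f K),
      cond1 <-> (forall K, adm K -> chains_stabilize f K),
      cond1 <-> (forall K, admN K -> no_factorization R f K)
    & cond1 <-> (forall K, admN K -> chains_stabilize f K)].
Proof.
move=> p_pr cf unb df cond1 adm admN.
have hf : qzhom p [set: G] (fun g => qp_seq (f g) 0) by apply: (defect_qzhom p_pr (R := R)); rewrite df.
have admN_adm K : admN K -> adm K.
  move=> [oK [sK _] [n iK nk]]; split=> //; exists n => //.
  by rewrite dvdn_leq // expn_gt0 prime_gt0.
(* The first condition gives the second for every admissible [K], in particular for the normal ones,
   and the normal ones alone give back the first. This closes the circle for both versions. *)
have cond_factor K : cond1 -> adm K -> no_factorization R f K.
  move=> c1 [oK sK iK]; apply: contrapT => /(factor_close_hom p_pr hf oK sK iK) le.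
  by move: c1; rewrite /cond1 ltNge le.
have factor_cond : (forall K, admN K -> no_factorization R f K) -> cond1.
  move=> h; rewrite /cond1 ltNge; apply/negP => /(close_hom_factor p_pr hf cf) [K aK].
  by apply; exact: h.
(* The second and third conditions are equivalent for each single [K]; unboundedness of [f] enters
   in the passage from the third to the second. *)
have stab K : adm K -> no_factorization R f K <-> chains_stabilize f K.
  move=> [oK sK [n iK _]].
  have hK : qzhom p K (fun g => qp_seq (f g) 0) by move=> x y _ _; exact: hf.
  split=> h; apply: contrapT.
    by move/(not_stabilize_factor p_pr sK hK) => /(_ R).
  move/(factor_not_stabilize p_pr sK oK _); apply => //.
  exact: (finite_index_unbounded (R := R) p_pr hf unb sK iK).
split; split=> h.
- by move=> K; exact: cond_factor.
- by apply: factor_cond => K /admN_adm; exact: h.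
- by move=> K aK; apply/(stab K aK); exact: cond_factor.
- by apply: factor_cond => K /admN_adm aK; apply/(stab K aK); exact: h.
- by move=> K /admN_adm; exact: cond_factor.
- exact: factor_cond.
- by move=> K /admN_adm aK; apply/(stab K aK); exact: cond_factor.
- by apply: factor_cond => K aK; apply/(stab K (admN_adm K aK)); exact: h.
Qed.
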